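(* Let $n,d$ be positive integers, $y_1,\dots,y_n\in\{-1,1\}$ and $\bar{x}_1,\dots,\bar{x}_n\in\mathbb{R}^{d+1}$ (no probabilistic assumptions). Let $H:\mathbb{R}^{d+1}\to\mathbb{R}^{(d+1)\times(d+1)}$ be $H(\theta)=\sum_{i=1}^n\psi(y_i\bar{x}_i\cdot\theta)\,\bar{x}_i\bar{x}_i^{\top}$, where $\psi(z)=\frac{\phi(z)}{\Phi(z)}\big(z+\frac{\phi(z)}{\Phi(z)}\big)$, and let $$L=\sup_{\theta\in\mathbb{R}^{d+1}}\lambda_{\max}(H(\theta)),\qquad m=\inf_{\theta\in\mathbb{R}^{d+1}}\lambda_{\min}(H(\theta)).$$ Define, for integers $s\in[0,n]$, $$P(s)=\inf_{v\in\mathbb{S}^d}\min_{I\subset\{1,\dots,n\}:|I|=s}\sum_{i\in I}|\bar{x}_i\cdot v|^2,\qquad s^*=\inf_{u\in\mathbb{S}^d}\sum_{i=1}^n\mathds{1}_{(-\infty,0]}(y_i\bar{x}_i\cdot u).$$ Then: (i) $L/m<\infty$ if and only if $\mathrm{Span}((\bar{x}_i)_{i\in I_u})=\mathbb{R}^{d+1}$ for every $u\in\mathbb{S}^d$, where $I_u=\{i\in\{1,\dots,n\}: y_i\bar{x}_i\cdot u\le 0\}$. (ii) If $(\bar{x}_i)_{i\in I}$ spans $\mathbb{R}^{d+1}$ for every $I\subset\{1,\dots,n\}$ with $|I|>d$, then $L/m<\infty$ if and only if $s^*>d$. (iii) $L/m\le \frac{\pi}{2}\,\lambda_{\max}\big(\sum_{i=1}^n\bar{x}_i\bar{x}_i^{\top}\big)/P(s^*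 )$.
   Context: $\Phi$ and $\phi$ denote the c.d.f. and p.d.f. of the standard normal distribution. $\mathbb{S}^d=\{v\in\mathbb{R}^{d+1}:|v|=1\}$. $\lambda_{\max},\lambda_{\min}$ are the largest and smallest eigenvalues of a symmetric positive semidefinite matrix. The ratio $L/m\in[1,\infty]$ is called the condition number, with $L/m=\infty$ when $m=0$. $H$ is the Hessian of the probit negative log-likelihood $\theta\mapsto-\sum_{i=1}^n\ln\Phi(y_i\bar{x}_i\cdot\theta)$. *)

(* Defs.v *)
From HB Require Import structures.
From mathcomp Require Import all_boot all_order all_algebra.
From mathcomp Require Import all_classical all_reals all_analysis.
Set Implicit Arguments. Unset Strict Implicit. Unset Printing Implicit Defensive.
Import Order.TTheory GRing.Theory Num.Theory.
Local Open Scope classical_set_scope.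
Local Open Scope ring_scope.

Section Probit.
Variable R : realType.

Definition phi (z : R) : R := normal_pdf 0 1 z.
Definition Phi (z : R) : R := fine (normal_prob 0 1 `]-oo, z]).

Definition psi (z : R) : R := phi z / Phi z * (z + phi z / Phi z).

Definition dot (k : nat) (u v : 'rV[R]_k) : R := (u *m v^T) 0 0.
Definition sphere (k : nat) : set 'rV[R]_k := [set v | Num.sqrt (dot v v) = 1].

Definition lambda_max (k : nat) (A : 'M[R]_k) : R := sup [set a | eigenvalue A a].
Definition lambda_min (k : nat) (A : 'M[R]_k) : R := inf [set a | eigenvalue A a].

Definition ediv (a b : \bar R) : \bar R :=
  if b == 0%E then +oo%E else (a * inve b)%E.

Variables (n d : nat) (y : 'I_n -> R) (x : 'I_n -> 'rV[R]_(d.+1)).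

(* Hessian of the probit negative log-likelihood *)
Definition Hess (theta : 'rV[R]_(d.+1)) : 'M[R]_(d.+1) :=
  \sum_(i < n) psi (y i * dot (x i) theta) *: ((x i)^T *m x i).

Definition Lsup : \bar R := ereal_sup (range (fun th => (lambda_max (Hess th))%:E)).
Definition minf : \bar R := ereal_inf (range (fun th => (lambda_min (Hess th))%:E)).

Definition condnum : \bar R := ediv Lsup minf.

Definition spans (I : {set 'I_n}) : bool := row_full (\sum_(i in I) <<x i>>)%MS.

Definition Iu (u : 'rV[R]_(d.+1)) : {set 'I_n} := [set i | y i * dot (x i) u <= 0].

(* P(s) for s in {0..n} (s given as a real number; only integer values matter)
   = inf_{v in S^d} min_{|I| = s} sum_{i in I} |x_i . v|^2 *)
Definition Pmin (s : R) : R :=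
  inf [set r | exists v, exists I : {set 'I_n},
         sphere v /\ (#|I|)%:R = s /\ r = \sum_(i in I) `|dot (x i) v| ^+ 2].

Definition sstar : R := inf [set (#|Iu u|)%:R | u in @sphere d.+1].

End Probit.

(* Main.v *)
(* Testing eigenvalues against unit vectors v reduces everything to the quadratic
   form v H(theta) v^T = sum_i psi(y_i x_i.theta) (x_i.v)^2. Three facts on psi
   are needed: 0 <= psi <= 1 everywhere, psi >= psi(0) = 2/pi on the negative
   axis, and psi(z) -> 0 as z -> +oo. The first one gives
   L <= lambda_max(sum_i x_i x_i^T). By the second one, the terms with index in
   I_u, where u = theta/|theta|, bound the form from below by
   2/pi sum_(i in I_u) (x_i.v)^2, uniformly in theta. This gives (iii), and
   m > 0 when all the families indexed by I_u span. Conversely, if v is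
   orthogonal to x_i for all i in I_u, then the form at theta = t u tends to 0
   as t -> +oo by the third fact, so m = 0.
   The bounds on psi are Mills-ratio estimates: each compares Phi with
   phi times an algebraic function by the sign of a derivative, both sides
   vanishing at -oo. *)
Require Import Defs.
From HB Require Import structures.
From mathcomp Require Import all_boot all_order all_algebra.
From mathcomp Require Import all_classical all_reals all_analysis.
From mathcomp Require Import ring lra.
Set Implicit Arguments. Unset Strict Implicit. Unset Printing Implicit Defensive.
Import Order.TTheory GRing.Theory Num.Theory.
Import numFieldNormedType.Exports.
Local Open Scope classical_set_scope.
Local Open Scope ring_scope.

(** * Density and distribution function of the standard normal law *)

Section NormalDistribution.
Variable R : realType.
Local Notation mu := (@lebesgue_measure R).
Local Notation phi := (@phi R).
Local Notation Phi := (@Phi R).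

Lemma phiE (z : R) : phi z = normal_peak 1 * expR (- (z ^+ 2) / 2).
Proof.
by rewrite /phi /Defs.phi normal_pdfE ?oner_neq0// /normal_fun subr0 expr1n.
Qed.

Lemma phi_gt0 (z : R) : 0 < phi z.
Proof. by rewrite phiE mulr_gt0 ?expR_gt0 ?normal_peak_gt0 ?oner_neq0. Qed.

Lemma phi_even (z : R) : phi (- z) = phi z.
Proof. by rewrite !phiE sqrrN. Qed.

(** Follows from [1 + a <= expR a] at [a = z ^+ 2 / 2]. This quadratic decay is the source of both
    limits taken later: [phi] at -oo and [psi] at +oo. *)
Lemma phi_le_rat (z : R) : phi z * (1 + z ^+ 2 / 2) <= normal_peak 1.
Proof.
rewrite phiE -mulrA ler_piMr ?normal_peak_ge0// mulNr expRN mulrC.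
by rewrite ler_pdivrMr ?expR_gt0// mul1r expR_ge1Dx.
Qed.

Global Instance is_derive_phi (z : R) : is_derive z 1 phi (- z * phi z).
Proof.
have -> : phi = (fun t => normal_peak 1 * expR (- (t ^+ 2) / 2)).
  by apply/funext => t; rewrite phiE.
apply: is_derive_eq.
rewrite /= !scaler0 ?addr0 ?add0r /GRing.scale /=.
by field.
Qed.

Lemma Phi_ge0 (z : R) : 0 <= Phi z.
Proof. exact/fine_ge0/measure_ge0. Qed.

Global Instance is_derive_Phi (z : R) : is_derive z 1 Phi (phi z).
Proof.
(* Integrating up to [z + 1] makes [z] an interior point for the fundamental theorem of calculus. *)
have zz1 : z < z + 1 by rewrite ltrDl.
have i1 : mu.-integrable `]-oo, z + 1] (EFin \o phi).
  by apply: (integrableS _ _ (subsetT _)) => //; exact: integrable_normal_pdf.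
have [||dF F'] := @continuous_FTC1 R phi -oo%O z (z + 1) zz1 i1.
  by rewrite ltNyr.
  by apply: continuous_normal_pdf; exact: oner_neq0.
have -> : Phi = (fun y => \int[mu]_(t in [set` Interval -oo%O (BRight y)]) phi t).
  by apply/funext.
by apply: DeriveDef; [exact: dF | rewrite -derive1E; exact: F'].
Qed.

(** Under the normal law, the identity is a random variable with c.d.f. [Phi], so the general limit
    of a c.d.f. at -oo applies. *)
Let idTR : measurableTypeR R -> R := idfun.

#[local] HB.instance Definition _ :=
  @isMeasurableFun.Build _ _ _ _ idTR (@measurable_id _ _ setT).

Lemma Phi_cvgNy : Phi z @[z --> -oo] --> 0.
Proof.
pose X : {RV (normal_prob (0 : R) 1) >-> R} := idTR.
have := @cvg_cdfNy0 _ _ _ _ X.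
by move=> /fine_cvgP[].
Qed.

(** Since [phi] is even, the total mass 1 is twice the mass of the positive half-line, which a
    reflection carries to the negative one. *)
Lemma Phi0 : Phi 0 = 2^-1.
Proof.
have cphi : continuous phi.
  by move=> t; apply: continuous_normal_pdf; exact: oner_neq0.
have phiN : phi =1 phi \o -%R by move=> t /=; rewrite phi_even.
have := @integral_normal_pdf R 0 1.
rewrite (ge0_symfun_integralT (fun t => ltW (phi_gt0 t)) cphi phiN).
have -> : [set t : R | 0 <= t] = `[0, +oo[%classic by rewrite set_itvcy.
rewrite (_ : \int[_]_(t in _) _ = normal_prob (0 : R)%R 1%R `]-oo, 0%R])%E; last first.
  have := @ge0_integration_by_substitutionNy R phi 0; rewrite oppr0.
  rewrite /normal_prob => ->.
  - by apply: eq_integral => t _; rewrite /= -/(phi _) phiN.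
  - exact: continuous_subspaceT.
  - by move=> t _; exact/ltW/phi_gt0.
have : normal_prob 0 1 `]-oo, 0 : R] \is a fin_num by exact: fin_num_measure.
rewrite /Phi /Defs.Phi => /fineK <- /=.
rewrite -EFinM => -[] e; apply: (@mulfI _ 2) => //.
by rewrite e divff.
Qed.

(** * Inequalities from the sign of a derivative, and decay at -oo *)

Lemma derivative_ge0_le (f f' : R -> R) (a b : R) : a <= b ->
  (forall z, a <= z <= b -> is_derive z 1 f (f' z)) ->
  (forall z, a <= z <= b -> 0 <= f' z) -> f a <= f b.
Proof.
move=> ab df f'0.
apply: (@ger0_derive1_le_cc R f a b) => //; rewrite ?in_itv /= ?lexx ?ab //.
- move=> z; rewrite in_itv /= => /andP[az zb].
  by apply: (@ex_derive _ _ _ _ _ _ _ (df z _)); rewrite !ltW.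
- move=> z; rewrite in_itv /= => /andP[az zb].
  have azb : a <= z <= b by rewrite !ltW.
  by rewrite derive1E (@derive_val _ _ _ _ _ _ _ (df z azb)) f'0.
- apply: derivable_within_continuous => z; rewrite in_itv /= => azb.
  exact: (@ex_derive _ _ _ _ _ _ _ (df z azb)).
Qed.

(** For [a] far to the left, [g a <= f a <= f b]; let [a] tend to -oo. A minorant [g] tending to 0
    spares computing the limit of [f]. *)
Lemma derivative_ge0_cvgNy_ge0 (f f' g : R -> R) (b : R) :
  g z @[z --> -oo] --> 0 -> (\forall z \near -oo, g z <= f z) ->
  (forall z, z <= b -> is_derive z 1 f (f' z)) ->
  (forall z, z <= b -> 0 <= f' z) -> 0 <= f b.
Proof.
move=> g0 gf df f'0; apply: (cvgr_to_le g0) => //.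
near=> a.
have ab : a <= b by near: a; exact: nbhs_ninfty_le (num_real _).
apply: (@le_trans _ _ (f a)); first by near: a.
apply: (@derivative_ge0_le f f') => //.
- by move=> z /andP[_ ?]; exact: df.
- by move=> z /andP[_ ?]; exact: f'0.
Unshelve. all: by end_near. Qed.

Lemma phi_cvgNy : phi z @[z --> -oo] --> 0.
Proof.
apply/cvgrPdist_le => e e0; near=> z.
rewrite sub0r normrN gtr0_norm ?phi_gt0//.
have K0 := @normal_peak_ge0 R 1; set K := normal_peak 1 in K0.
(* For such [z], [z ^+ 2 / 2] exceeds [K / e], so [e < phi z] would contradict [phi_le_rat]. *)
have zM : z <= - (1 + 2 * K / e) by near: z; exact: nbhs_ninfty_le (num_real _).
rewrite leNgt; apply/negP => ephi.
have := phi_le_rat z; rewrite -/K leNgt => /negP; apply.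
have Ke0 : 0 <= K / e by rewrite divr_ge0 // ltW.
have -> : K = e * (K / e) by field; rewrite gt_eqF.
set q := K / e in Ke0 zM *.
have z2 : 1 + 2 * q <= z ^+ 2 by rewrite -mulrA -/q in zM; nra.
apply: le_lt_trans (_ : e * (1 + z ^+ 2 / 2) < _).
  by rewrite ler_pM2l //; lra.
by rewrite ltr_pM2r //; nra.
Unshelve. all: by end_near. Qed.

(** * Mills-ratio bounds *)

Lemma is_derive_sqrt_sqrD (c t : R) : 0 < c ->
  is_derive t 1 (fun u => Num.sqrt (u ^+ 2 + c)) (t / Num.sqrt (t ^+ 2 + c)).
Proof.
move=> c0; have s0 : 0 < t ^+ 2 + c by rewrite ltr_wpDl ?sqr_ge0.
have d1 := is_derive1_sqrt s0.
have d2 : is_derive t 1 (fun u : R => u ^+ 2 + c) (2 * t).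
  apply: is_derive_eq; rewrite /= addr0 /GRing.scale /=; ring.
have := @is_derive1_comp _ Num.sqrt (fun u => u ^+ 2 + c) _ _ _ d1 d2.
move=> d; apply: (is_derive_eq d).
by field; rewrite gt_eqF ?sqrtr_gt0.
Qed.

(** Birnbaum's inequality, reflected to the left tail. It is what makes [psi <= 1]. *)
Lemma Phi_lower (z : R) : phi z * ((Num.sqrt (z ^+ 2 + 4) + z) / 2) <= Phi z.
Proof.
have s0 (t : R) : 0 < t ^+ 2 + 4 by rewrite ltr_wpDl ?sqr_ge0.
pose s (t : R) : R := Num.sqrt (t ^+ 2 + 4).
pose f (t : R) : R := Phi t - phi t * ((s t + t) / 2).
have sgt0 t : 0 < s t by rewrite sqrtr_gt0.
have s2 t : s t ^+ 2 = t ^+ 2 + 4 by rewrite sqr_sqrtr // ltW.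
have ds (t : R) : is_derive t 1 s (t / s t) by exact: is_derive_sqrt_sqrD.
rewrite -subr_ge0 -/(f z).
have Nphi0 : - phi t @[t --> -oo] --> 0 by rewrite -oppr0; exact: cvgN phi_cvgNy.
apply: (@derivative_ge0_cvgNy_ge0 f
  (fun t => phi t * (1 - (t / s t + 1 - t * (s t + t)) / 2))
  (fun t => - phi t) z Nphi0).
- near=> t; have t0 : t <= 0 by near: t; exact: nbhs_ninfty_le (num_real _).
  rewrite /f -[leLHS]add0r lerD ?Phi_ge0// lerN2 ler_piMr ?(ltW (phi_gt0 _))//.
  suff : s t <= 2 - t by lra.
  by rewrite -ler_sqr ?nnegrE ?s2 ?(ltW (sgt0 t))//; nra.
- move=> t _; rewrite /f; apply: is_derive_eq.
  rewrite /GRing.scale /=; field.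
  by rewrite gt_eqF.
- move=> t _; rewrite mulr_ge0 ?(ltW (phi_gt0 _))//.
  have st := sgt0 t; have st2 := s2 t.
  (* The derivative has the sign of the difference of these two sides. For [t < 0] both are
     nonnegative, and their squares differ by exactly 4. *)
  have key : - t * (t ^+ 2 + 3) <= s t * (1 + t ^+ 2).
    have [t0|t0] := leP 0 t.
      apply: (@le_trans _ _ 0); last by rewrite mulr_ge0 ?ltW// ltr_wpDr ?sqr_ge0.
      by rewrite mulNr oppr_le0 mulr_ge0// addr_ge0 ?sqr_ge0.
    rewrite -ler_sqr ?nnegrE ?mulr_ge0 ?addr_ge0 ?sqr_ge0 ?oppr_ge0 ?ltW//.
    by rewrite !exprMn st2 sqrrN; nra.
  have : 0 <= s t * (1 - (t / s t + 1 - t * (s t + t)) / 2).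
    have -> : s t * (1 - (t / s t + 1 - t * (s t + t)) / 2)
       = (s t * (1 + t ^+ 2) + t * (s t ^+ 2 - 1)) / 2.
      by field; rewrite gt_eqF.
    by rewrite st2; lra.
  by rewrite pmulr_rge0.
Unshelve. all: by end_near. Qed.

Lemma Phi_gt0 (z : R) : 0 < Phi z.
Proof.
apply: lt_le_trans (Phi_lower z); rewrite mulr_gt0 ?phi_gt0// divr_gt0//.
have [z0|z0] := leP 0 z; first by rewrite ltr_wpDr// sqrtr_gt0 ltr_wpDl// sqr_ge0.
rewrite -ltrBlDr sub0r -ltr_sqr ?nnegrE ?sqrtr_ge0 ?oppr_ge0 ?ltW//.
by rewrite sqr_sqrtr ?sqrrN ?ltrDl// addr_ge0 ?sqr_ge0.
Qed.

(** The difference [phi t / (- t) - Phi t] has derivative [phi t / t ^+ 2], which is nonnegative. *)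
Lemma Phi_upper (z : R) : z < 0 -> - z * Phi z <= phi z.
Proof.
move=> z0; rewrite mulrC -ler_pdivlMr ?oppr_gt0// -subr_ge0.
have NPhi0 : - Phi t @[t --> -oo] --> 0 by rewrite -oppr0; exact: cvgN Phi_cvgNy.
apply: (@derivative_ge0_cvgNy_ge0 (fun t => phi t / (- t) - Phi t)
  (fun t => phi t / t ^+ 2) (fun t => - Phi t) z NPhi0).
- near=> t; have t0 : t <= 0 by near: t; exact: nbhs_ninfty_le (num_real _).
  by rewrite lerDr divr_ge0 ?(ltW (phi_gt0 _))// oppr_ge0.
- move=> t tz; have t0 : t != 0 by rewrite lt_eqF// (le_lt_trans tz).
  have dinv : is_derive t 1 (fun u : R => (- u)^-1) (t ^- 2).
    have Nt0 : - t != 0 by rewrite oppr_eq0.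
    have dN : is_derive t 1 (-%R : R -> R) (-1) by apply: is_derive_eq.
    apply: (is_derive_eq (is_deriveV Nt0 dN)).
    by rewrite /GRing.scale /=; field.
  apply: is_derive_eq; rewrite /GRing.scale /=.
  by field.
- by move=> t _; rewrite divr_ge0 ?sqr_ge0// ltW ?phi_gt0.
Unshelve. all: by end_near. Qed.

(** Equality case at 0 of the upper bound [Phi_upper_pi]; the constants [8 / pi] and [pi / 4] are
    tuned for it. *)
Lemma Phi0_phi0 : phi 0 * (Num.sqrt (8 / pi) * (pi / 4)) = Phi 0.
Proof.
have p0 := pi_gt0 R.
rewrite Phi0 phiE expr0n /= oppr0 mul0r expR0 mulr1 /normal_peak expr1n mul1r.
move: (pi : R) p0 => p p0.
set a := Num.sqrt (8 / p); set b := Num.sqrt (p *+ 2).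
have b0 : 0 < b by rewrite sqrtr_gt0 pmulrn_lgt0.
have b2 : b ^+ 2 = 2 * p by rewrite sqr_sqrtr ?mulr_natl// mulrn_wge0// ltW.
have ab : a * b = 4.
  rewrite -sqrtrM ?divr_ge0 ?ltW// (_ : _ * _ = 4 ^+ 2); last first.
    by rewrite -mulr_natl; field; rewrite gt_eqF.
  by rewrite sqrtr_sqr ger0_norm.
have -> : a = 4 / b by rewrite -ab; field; rewrite gt_eqF.
have -> : b^-1 * (4 / b * (p / 4)) = p / b ^+ 2 by field; rewrite gt_eqF.
by rewrite b2; field; rewrite gt_eqF.
Qed.

(* Pollak's bound. The derivative of the difference of the two sides changes
   sign once on the negative axis, and the difference vanishes at both ends. *)
Lemma Phi_upper_pi (z : R) : z <= 0 ->
  Phi z <= phi z * ((Num.sqrt (z ^+ 2 + 8 / pi) + z) * (pi / 4)).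
Proof.
move=> z0; have p0 := pi_gt0 R; have p2 := pi_ge2 R.
have p4 : pi < 4 :> R by have := pihalf_lt2 R; lra.
move: (pi : R) Phi0_phi0 p0 p2 p4 => p Phi0_p p0 p2 p4.
have [c cE] : exists c, 8 / p = c by exists (8 / p).
rewrite cE.
have pc : p / 4 = 2 / c by rewrite -cE; field; rewrite gt_eqF.
(* [2 < c] makes [A] and [B] below nonnegative, and [c <= 4] makes [D] nonincreasing on the negative
   axis. *)
have c2 : 2 < c by rewrite -cE ltr_pdivlMr//; lra.
have c4 : c <= 4 by rewrite -cE ler_pdivrMr//; lra.
have c0 : 0 < c by lra.
rewrite pc.
have s0 (t : R) : 0 < t ^+ 2 + c by rewrite ltr_wpDl ?sqr_ge0.
pose s (t : R) : R := Num.sqrt (t ^+ 2 + c).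
pose f (t : R) : R := phi t * ((s t + t) * (2 / c)) - Phi t.
have sgt0 t : 0 < s t by rewrite sqrtr_gt0.
have s2 t : s t ^+ 2 = t ^+ 2 + c by rewrite sqr_sqrtr // ltW.
have ds (t : R) : is_derive t 1 s (t / s t) by exact: is_derive_sqrt_sqrD.
pose E t := t * (1 - s t ^+ 2) + s t * (1 - t ^+ 2 - c / 2).
pose f' t := phi t * (2 / c / s t * E t).
have df (t : R) : is_derive t 1 f (f' t).
  rewrite /f; apply: is_derive_eq; rewrite /f' /E.
  rewrite /GRing.scale /=; field.
  by rewrite !gt_eqF.
pose D t := (4 - c) * t ^+ 2 - (c - 2) ^+ 2.
(* [E] carries the sign of the derivative. Writing it as [A - B] and squaring removes the root:
   [A ^+ 2 - B ^+ 2] is a positive multiple of [D]. *)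
have E_D t : t <= 0 -> (0 <= D t -> 0 <= E t) /\ (D t <= 0 -> E t <= 0).
  move=> t0; pose A := - t * (t ^+ 2 + c - 1); pose B := s t * (t ^+ 2 + c / 2 - 1).
  have t2 := sqr_ge0 t.
  have A0 : 0 <= A by rewrite mulr_ge0 ?oppr_ge0//; lra.
  have B0 : 0 <= B by rewrite mulr_ge0 ?ltW//; lra.
  have -> : E t = A - B by rewrite /E /A /B s2; ring.
  have AB : A ^+ 2 - B ^+ 2 = c / 4 * D t.
    by rewrite /A /B /D !exprMn s2; field.
  split => D0.
    by rewrite subr_ge0 -ler_sqr ?nnegrE// -subr_ge0 AB mulr_ge0// divr_ge0// ltW.
  rewrite subr_le0 -ler_sqr ?nnegrE// -subr_le0 AB pmulr_rle0//.
  by rewrite divr_gt0.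
have k0 t : 0 < 2 / c / s t by rewrite !divr_gt0.
have D_mono a b : a <= b -> b <= 0 -> D b <= D a.
  move=> ab b0; rewrite /D lerD2r ler_wpM2l ?subr_ge0//; nra.
rewrite -subr_ge0 -/(f z).
(* Either [f] is nondecreasing on all of ]-oo, z], and is compared with its behaviour at -oo, or it
   is nonincreasing on [z, 0], and is compared with [f 0 = 0]. *)
have [Dz|/ltW Dz] := leP 0 (D z).
  have NPhi0 : - Phi t @[t --> -oo] --> 0.
    by rewrite -oppr0; exact: cvgN Phi_cvgNy.
  apply: (@derivative_ge0_cvgNy_ge0 f f' (fun t => - Phi t) z NPhi0) => //.
    near=> t; rewrite lerDr !mulr_ge0 ?(ltW (phi_gt0 _)) ?invr_ge0 ?(ltW c0)//.
    have t0 : t <= 0 by near: t; exact: nbhs_ninfty_le (num_real _).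
    rewrite -lerBlDr sub0r -ler_sqr ?nnegrE ?oppr_ge0 ?(ltW (sgt0 t))//.
    by rewrite s2 sqrrN lerDl ltW.
  move=> t tz; have t0 := le_trans tz z0.
  rewrite /f' mulr_ge0 ?(ltW (phi_gt0 _))// mulr_ge0 ?(ltW (k0 _))//.
  by apply: (E_D _ t0).1; rewrite (le_trans Dz) ?D_mono.
have f0 : f 0 = 0.
  by rewrite /f /s expr0n /= add0r addr0 -pc -cE Phi0_p subrr.
have : - f z <= - f 0.
  apply: (@derivative_ge0_le (fun t => - f t) (fun t => - f' t)) => //.
  move=> t /andP[zt t0]; rewrite oppr_ge0 /f' pmulr_rle0 ?phi_gt0// pmulr_rle0//.
  by apply: (E_D _ t0).2; rewrite (le_trans _ Dz) ?D_mono.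
by rewrite f0 oppr0 oppr_le0.
Unshelve. all: by end_near. Qed.

(** * Bounds on [psi] *)

Local Notation psi := (@psi R).

Lemma psi_ge0 (z : R) : 0 <= psi z.
Proof.
have r0 : 0 <= phi z / Phi z by rewrite divr_ge0 ?ltW ?phi_gt0 ?Phi_gt0.
rewrite mulr_ge0//; have [z0|z0] := leP 0 z; first exact: addr_ge0.
by rewrite -lerBlDl sub0r ler_pdivlMr ?Phi_gt0 ?Phi_upper.
Qed.

(** With [s = Num.sqrt (z ^+ 2 + 4)], the positive root of [r * (z + r) = 1] is [(s - z) / 2], and
    [Phi_lower] says that [phi z / Phi z] does not exceed it. *)
Lemma psi_le1 (z : R) : psi z <= 1.
Proof.
have F0 := Phi_gt0 z; have p0 := phi_gt0 z.
have := Phi_lower z; set s := Num.sqrt _ => lo.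
have s2 : s ^+ 2 = z ^+ 2 + 4 by rewrite sqr_sqrtr// addr_ge0 ?sqr_ge0.
have sz : 0 < s - z.
  rewrite subr_gt0; have [z0|z0] := leP z 0; last first.
    by rewrite -ltr_sqr ?nnegrE ?sqrtr_ge0 ?ltW// s2 ltrDl.
  by rewrite (le_lt_trans z0)// sqrtr_gt0 ltr_wpDl ?sqr_ge0.
have rle : phi z / Phi z <= (s - z) / 2.
  rewrite ler_pdivrMr//.
  apply: (@le_trans _ _ ((s - z) / 2 * (phi z * ((s + z) / 2)))); last first.
    by rewrite ler_pM2l// divr_gt0.
  have -> : (s - z) / 2 * (phi z * ((s + z) / 2)) = phi z * (s ^+ 2 - z ^+ 2) / 4.
    by field.
  by rewrite s2; lra.
have r0 : 0 <= phi z / Phi z by rewrite divr_ge0 ?ltW.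
apply: (@le_trans _ _ (phi z / Phi z * ((s + z) / 2))).
  by rewrite /psi /Defs.psi ler_wpM2l//; lra.
have sz' : 0 < s + z by nra.
apply: (@le_trans _ _ ((s - z) / 2 * ((s + z) / 2))).
  by rewrite ler_pM2r// divr_gt0.
have -> : (s - z) / 2 * ((s + z) / 2) = (s ^+ 2 - z ^+ 2) / 4 by field.
by rewrite s2; lra.
Qed.

(** Mirror image of [psi_le1]: by [Phi_upper_pi], the ratio [phi z / Phi z] is at least the positive
    root of [r * (z + r) = 2 / pi]. *)
Lemma psi_ge_2pi (z : R) : z <= 0 -> 2 / pi <= psi z.
Proof.
move=> z0; have F0 := Phi_gt0 z; have p0 := phi_gt0 z; have pi0 := pi_gt0 R.
have := Phi_upper_pi z0; move: (pi : R) pi0 => p pi0.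
set s := Num.sqrt _ => up.
have s2 : s ^+ 2 = z ^+ 2 + 8 / p.
  by rewrite sqr_sqrtr// addr_ge0 ?sqr_ge0 ?divr_ge0 ?ltW.
have sz : 0 < s - z.
  have : 0 < s by rewrite sqrtr_gt0 ltr_wpDl ?sqr_ge0// divr_gt0.
  lra.
have sz' : 0 < s + z.
  rewrite -(pmulr_rgt0 _ sz).
  have -> : (s - z) * (s + z) = s ^+ 2 - z ^+ 2 by ring.
  by rewrite s2 addrAC subrr add0r divr_gt0.
have rge : (s - z) / 2 <= phi z / Phi z.
  rewrite ler_pdivlMr//.
  apply: le_trans (_ : (s - z) / 2 * (phi z * ((s + z) * (p / 4))) <= _).
    by rewrite ler_pM2l// divr_gt0.
  have -> : (s - z) / 2 * (phi z * ((s + z) * (p / 4)))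
      = phi z * (s ^+ 2 - z ^+ 2) * p / 8 by field.
  by rewrite s2 [_ - z ^+ 2]addrAC subrr add0r le_eqVlt; apply/orP; left;
    apply/eqP; field; rewrite gt_eqF.
have -> : 2 / p = (s - z) / 2 * ((s + z) / 2).
  have -> : (s - z) / 2 * ((s + z) / 2) = (s ^+ 2 - z ^+ 2) / 4 by field.
  by rewrite s2; field; rewrite gt_eqF.
by rewrite /psi /Defs.psi ler_pM ?divr_ge0 ?(ltW sz) ?(ltW sz')//; lra.
Qed.

(** Quantitative decay at +oo: [Phi z >= 1 / 2] gives [phi z / Phi z <= 2 * phi z], and
    [phi z * z ^+ 2 <= 2] does the rest. *)
Lemma psi_le_inv (z : R) : 2 <= z -> psi z <= 8 / z.
Proof.
move=> z2; have p0 := phi_gt0 z.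
have z0 : 0 < z by lra.
have K1 : normal_peak 1 <= 1 :> R.
  rewrite /normal_peak expr1n mul1r; move: (pi : R) (pi_ge2 R) => p p2.
  have p1 : 1 <= p *+ 2 by lra.
  rewrite invf_le1 ?sqrtr_gt0 ?(lt_le_trans _ p1)//.
  by rewrite -[leLHS]sqrtr1 ler_sqrt ?(le_trans _ p1).
have Fh : 2^-1 <= Phi z.
  rewrite -Phi0; apply: (@derivative_ge0_le Phi phi) => [|t _]; first exact: ltW.
  exact/ltW/phi_gt0.
have rle : phi z / Phi z <= 2 * phi z.
  by rewrite ler_pdivrMr ?Phi_gt0//; nra.
have ple := le_trans (phi_le_rat z) K1.
have r0 : 0 <= phi z / Phi z by rewrite divr_ge0 ?ltW ?Phi_gt0.
have p1 : phi z * z ^+ 2 <= 2 by lra.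
have p2 : phi z <= 1 by nra.
apply: (@le_trans _ _ (2 * phi z * (z + 2 * phi z))).
  by rewrite /psi /Defs.psi ler_pM ?lerD2l// addr_ge0// ltW.
by rewrite ler_pdivlMr//; nra.
Qed.

End NormalDistribution.

(** * Bilinearity, positivity and normalization for [dot] *)

Section DotProduct.
Variables (R : realType) (k : nat).
Implicit Types (u v w : 'rV[R]_k) (A : 'M[R]_k).

Lemma dotE u v : dot u v = \sum_i u 0 i * v 0 i.
Proof. by rewrite /dot mxE; apply: eq_bigr => i _; rewrite mxE. Qed.

Lemma dotC u v : dot u v = dot v u.
Proof. by rewrite !dotE; apply: eq_bigr => i _; rewrite mulrC. Qed.

Lemma dotDl u v w : dot (u + v) w = dot u w + dot v w.
Proof. by rewrite /dot mulmxDl mxE. Qed.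

Lemma dotZl (a : R) u v : dot (a *: u) v = a * dot u v.
Proof. by rewrite /dot -scalemxAl mxE. Qed.

Lemma dotDr u v w : dot u (v + w) = dot u v + dot u w.
Proof. by rewrite dotC dotDl !(dotC u). Qed.

Lemma dotZr (a : R) u v : dot u (a *: v) = a * dot u v.
Proof. by rewrite dotC dotZl dotC. Qed.

Lemma dot_ge0 v : 0 <= dot v v.
Proof. by rewrite dotE sumr_ge0// => i _; rewrite -expr2 sqr_ge0. Qed.

Lemma dot_eq0 v : (dot v v == 0) = (v == 0).
Proof.
apply/idP/eqP => [|->]; last by rewrite /dot mul0mx mxE.
rewrite dotE psumr_eq0 => [/allP v0|i _]; last by rewrite -expr2 sqr_ge0.
apply/rowP => i; rewrite mxE.
have := v0 i; rewrite mem_index_enum => /(_ isT).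
by rewrite mulf_eq0 orbb => /eqP.
Qed.

Lemma dot_gt0 v : (0 < dot v v) = (v != 0).
Proof. by rewrite lt_def dot_ge0 andbT dot_eq0. Qed.

Lemma sphereP v : sphere v <-> dot v v = 1.
Proof.
rewrite /sphere /=; split => [v1|->]; last exact: sqrtr1.
by rewrite -[LHS]sqr_sqrtr ?dot_ge0// v1 expr1n.
Qed.

Lemma normalize v : v != 0 -> sphere ((Num.sqrt (dot v v))^-1 *: v).
Proof.
move=> v0; apply/sphereP; rewrite dotZl dotZr mulrA -expr2 exprVn sqr_sqrtr ?dot_ge0//.
by rewrite mulVf// dot_eq0.
Qed.

Lemma dot_mulmx_sym A u v : A^T = A -> dot (u *m A) v = dot (v *m A) u.
Proof.
by move=> sA; rewrite [RHS]dotC /dot trmx_mul sA mulmxA.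
Qed.

End DotProduct.

(** * Extreme eigenvalues of symmetric matrices by Rayleigh quotients *)

Section Rayleigh.
Variables (R : realType) (k : nat).
Implicit Types (v : 'rV[R]_k.+1) (A : 'M[R]_k.+1).

Lemma continuous_dot_mulmx A :
  continuous (fun v : 'rV[R]_k.+1 => dot (v *m A) v).
Proof.
have -> : (fun v => dot (v *m A) v) =
    (fun v => \sum_j (\sum_i v 0 i * A i j) * v 0 j).
  apply/funext => v; rewrite dotE; apply: eq_bigr => j _.
  by rewrite mxE.
have coord i : continuous (fun v : 'rV[R]_k.+1 => v 0 i : R).
  exact: coord_continuous.
have coordA j : continuous (fun v : 'rV[R]_k.+1 => \sum_i v 0 i * A i j : R).
  apply: continuous_big => [|i _]; first exact: add_continuous.
  by move=> v; apply: continuousM; [exact: coord | exact: cst_continuous].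
apply: continuous_big => [|j _]; first exact: add_continuous.
by move=> v; apply: continuousM; [exact: coordA | exact: coord].
Qed.

Lemma compact_sphere : compact (@sphere R k.+1).
Proof.
have sE : @sphere R k.+1 = (fun v => dot (v *m 1%:M) v) @^-1` [set 1].
  by apply/seteqP; split => v /=; rewrite mulmx1 => /sphereP.
apply: bounded_closed_compact; last first.
  rewrite sE; apply: preimage_closed; last exact: closed_eq.
  by move=> v _; exact: continuous_dot_mulmx.
exists 1; split => // M M1 v /sphereP v1; apply: le_trans (ltW M1).
rewrite [leLHS]/Num.Def.normr/= mx_normrE (bigmax_le _ ler01)//= => -[i j] _ /=.
rewrite ord1 -ler_sqr ?nnegrE// expr1n real_normK ?num_real// -v1 dotE.
rewrite (bigD1 j)//= -expr2 lerDl sumr_ge0// => l _.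
by rewrite -expr2 sqr_ge0.
Qed.

Lemma exists_sphere : exists u : 'rV[R]_k.+1, sphere u.
Proof.
pose e : 'rV[R]_k.+1 := const_mx 1.
exists ((Num.sqrt (dot e e))^-1 *: e); apply: normalize.
by apply/eqP => /matrixP/(_ 0 0); rewrite !mxE; exact/eqP/oner_neq0.
Qed.

(** The quadratic form attains its minimum on the compact sphere, and a minimizer is an eigenvector
    by a first-order perturbation argument. *)
Lemma symmetric_min_eigenvalue A : A^T = A ->
  exists a, eigenvalue A a /\ forall v, a * dot v v <= dot (v *m A) v.
Proof.
move=> sA.
have cA : {within @sphere R k.+1, continuous (fun v => dot (v *m A) v)}.
  exact/continuous_subspaceT/continuous_dot_mulmx.
have [v] := EVT_min_rV exists_sphere compact_sphere cA.
rewrite inE => vS vmin; pose a := dot (v *m A) v.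
have v1 : dot v v = 1 by apply/sphereP.
have ray w : a * dot w w <= dot (w *m A) w.
  have [->|w0] := eqVneq w 0; first by rewrite !mul0mx /dot !mul0mx !mxE mulr0.
  have := vmin _ (mem_set (normalize w0)).
  rewrite -scalemxAl dotZl dotZr mulrA -expr2 exprVn sqr_sqrtr ?dot_ge0//.
  by rewrite mulrC ler_pdivlMr ?dot_gt0.
exists a; split => //; apply/eigenvalueP; exists v; last first.
  by rewrite -dot_eq0 v1 oner_neq0.
apply/eqP; rewrite -subr_eq0 -dot_eq0.
have [w wE] : exists w, v *m A - a *: v = w by eexists.
rewrite wE; set D := dot w w.
pose Q := dot (w *m A) w - a * dot w w.
have Q0 : 0 <= Q by rewrite subr_ge0.
have vw : dot (v *m A) w - a * dot v w = D.
  by rewrite -mulNr -dotZl -dotDl scaleNr wE.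
(* Minimality of [v] tested along the residual [w]; the goal is [D = 0]. *)
have key (t : R) : 0 <= 2 * t * D + t ^+ 2 * Q.
  have := ray (v + t *: w); rewrite -subr_ge0; congr (0 <= _).
  rewrite mulmxDl -scalemxAl !(dotDl, dotDr, dotZl, dotZr).
  rewrite (dot_mulmx_sym w v sA) (dotC w v) -/a v1 /Q -vw.
  ring.
have D0 : 0 <= D := dot_ge0 _.
(* A negative [t] of this size makes the linear term dominate. The denominator is [Q + 1] because
   [Q] may vanish. *)
have := key (- D / (Q + 1)).
have -> : 2 * (- D / (Q + 1)) * D + (- D / (Q + 1)) ^+ 2 * Q =
   - ((D / (Q + 1)) ^+ 2 * (Q + 2)).
  by field; rewrite gt_eqF// ltr_wpDl.
rewrite oppr_ge0 pmulr_lle0; last by rewrite ltr_wpDl.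
rewrite le_eqVlt ltNge sqr_ge0 orbF sqrf_eq0 mulf_eq0 invr_eq0.
by rewrite [Q + 1 == 0]gt_eqF ?orbF// ltr_wpDl.
Qed.

Lemma dot_eigenvector {A a v} : v *m A = a *: v ->
  dot (v *m A) v = a * dot v v.
Proof. by move=> ->; rewrite dotZl. Qed.

(** The infimum in [lambda_min] is attained, so it is a genuine eigenvalue as well as a bound on the
    form. *)
Lemma lambda_minP A : A^T = A -> eigenvalue A (lambda_min A) /\
  forall v, lambda_min A * dot v v <= dot (v *m A) v.
Proof.
move=> /symmetric_min_eigenvalue[a [ea ray]].
suff -> : lambda_min A = a by [].
have lb : lbound [set b | eigenvalue A b] a.
  move=> b /eigenvalueP[v /dot_eigenvector vE v0].
  by have := ray v; rewrite vE ler_pM2r ?dot_gt0.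
apply/eqP; rewrite eq_le; apply/andP; split.
  by apply: ge_inf => //; exists a.
by apply: lb_le_inf => //; exists a.
Qed.

Lemma lambda_maxP A : A^T = A -> eigenvalue A (lambda_max A) /\
  forall v, dot (v *m A) v <= lambda_max A * dot v v.
Proof.
move=> sA; have [|a [ea ray]] := @symmetric_min_eigenvalue (- A).
  by rewrite raddfN /= sA.
have ray' v : dot (v *m A) v <= - a * dot v v.
  have := ray v; rewrite mulmxN -scaleN1r dotZl mulN1r mulNr.
  by rewrite lerNr.
have ea' : eigenvalue A (- a).
  move/eigenvalueP: ea => [v vE v0]; apply/eigenvalueP; exists v => //.
  by rewrite scaleNr -vE mulmxN opprK.
suff -> : lambda_max A = - a by [].
have ub : ubound [set b | eigenvalue A b] (- a).
  move=> b /eigenvalueP[v /dot_eigenvector vE v0].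
  by have := ray' v; rewrite vE ler_pM2r ?dot_gt0.
apply/eqP; rewrite eq_le; apply/andP; split.
  by apply: ge_sup => //; exists (- a).
by apply: ub_le_sup => //; exists (- a).
Qed.

End Rayleigh.

(** * Unit eigenvectors, and selection in finite types *)

Lemma eigenvalue_sphere (R : realType) k (A : 'M[R]_k) (a : R) :
  eigenvalue A a -> exists2 v, sphere v & dot (v *m A) v = a.
Proof.
move=> /eigenvalueP[v vE v0]; exists ((Num.sqrt (dot v v))^-1 *: v).
  exact: normalize.
have /sphereP v1 := normalize v0.
by rewrite -[RHS]mulr1 -v1 -dotZl -scalemxAl vE scalerA mulrC -scalerA.
Qed.

Lemma exists_subset_card (T : finType) (A : {set T}) (m : nat) :
  (m <= #|A|)%N -> exists2 B : {set T}, B \subset A & #|B| = m.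
Proof.
move=> mA; exists [set z in take m (enum A)].
  by apply/fintype.subsetP => z; rewrite inE => /mem_take; rewrite mem_enum.
rewrite cardsE (card_uniqP _) ?size_take ?take_uniq ?enum_uniq//.
by rewrite -cardE; case: ltngtP mA.
Qed.

Lemma exists_lower_bound (R : realType) (T : finType) (f : T -> R) (P : pred T) :
  (forall t, P t -> 0 < f t) -> exists2 c, 0 < c & forall t, P t -> c <= f t.
Proof.
move=> f0; exists (\big[Order.min/1]_(t | P t) f t).
  by apply: lt_bigmin.
by move=> t Pt; exact: bigmin_le_cond.
Qed.

(** * Weighted Gram matrices, spanning families and the Hessian *)

Section Probit.
Variables (R : realType) (n d : nat) (y : 'I_n -> R) (x : 'I_n -> 'rV[R]_d.+1).

(** Covers the Hessian (weights [psi]), the full Gram matrix (weights 1) and its restriction to an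
    index set (0/1 weights). *)
Local Notation gram w := (\sum_(i < n) w i *: ((x i)^T *m x i)).

Lemma gram_sym (w : 'I_n -> R) : (gram w)^T = gram w.
Proof.
rewrite raddf_sum /=; apply: eq_bigr => i _.
by rewrite linearZ /= trmx_mul trmxK.
Qed.

Lemma dot_gram (w : 'I_n -> R) v :
  dot (v *m gram w) v = \sum_(i < n) w i * dot (x i) v ^+ 2.
Proof.
rewrite /dot mulmx_sumr mulmx_suml summxE; apply: eq_bigr => i _.
rewrite -scalemxAr -scalemxAl mxE; congr (_ * _).
rewrite (mulmxA v) -(mulmxA (v *m _)) mxE big_ord1 expr2; congr (_ * _).
exact: dotC.
Qed.

Lemma gram1E : \sum_(i < n) (x i)^T *m x i = gram (fun=> 1).
Proof. by apply: eq_bigr => i _; rewrite scale1r. Qed.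

(** If the family spans, the kernel of [v^T] is everything. Conversely, the columns of [cokermx M]
    are orthogonal to the family, so they vanish and [M] has full rank. *)
Lemma spansP (I : {set 'I_n}) :
  reflect (forall v, (forall i, i \in I -> dot (x i) v = 0) -> v = 0) (spans x I).
Proof.
rewrite /spans; set M := (\sum_(i in I) <<x i>>)%MS.
apply: (iffP idP) => [fullM v xv0|ortho].
  have MK : (M <= kermx v^T)%MS.
    apply/sumsmx_subP => i iI; rewrite genmxE; apply/sub_kermxP/matrixP => a b.
    by rewrite !ord1 [RHS]mxE; exact: xv0.
  have : (1%:M <= kermx v^T)%MS by rewrite (submx_trans _ MK)// sub1mx.
  by move/sub_kermxP; rewrite mul1mx => /(congr1 trmx); rewrite trmxK trmx0.
rewrite -cokermx_eq0; apply/eqP/matrixP => a b; rewrite mxE.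
suff /rowP/(_ a) : (col b (cokermx M))^T = 0 by rewrite !mxE.
apply: ortho => i iI; rewrite /dot trmxK colE mulmxA.
have : (x i <= M)%MS by rewrite (submx_trans _ (sumsmx_sup i _ (submx_refl _)))// genmxE.
by rewrite submxE => /eqP ->; rewrite mul0mx mxE.
Qed.

Lemma spans_card (I : {set 'I_n}) : spans x I -> (d < #|I|)%N.
Proof.
rewrite /spans /row_full => /eqP <-; apply: leq_trans (mxrank_sum_leqif _).1 _ => /=.
rewrite -sum1_card leq_sum// => i _.
by rewrite genmxE rank_leq_row.
Qed.

(** The constant is the least eigenvalue of the Gram matrix restricted to [I]. It is positive, as a
    unit eigenvector cannot be orthogonal to a spanning family. *)
Lemma spans_bound (I : {set 'I_n}) : spans x I ->
  exists2 c, 0 < c & forall v, sphere v -> c <= \sum_(i in I) dot (x i) v ^+ 2.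
Proof.
move=> spI; pose w i : R := (i \in I)%:R.
have wE v : dot (v *m gram w) v = \sum_(i in I) dot (x i) v ^+ 2.
  rewrite dot_gram [RHS]big_mkcond; apply: eq_bigr => i _.
  by rewrite /w; case: (i \in I); rewrite ?mul1r ?mul0r.
have [/eigenvalue_sphere[v v1 vE] ray] := lambda_minP (gram_sym w).
exists (lambda_min (gram w)) => [|u /sphereP u1]; last first.
  by rewrite -wE -[leLHS]mulr1 -u1.
rewrite -vE wE lt_def sumr_ge0 ?andbT => [|i _]; last exact: sqr_ge0.
apply/negP; rewrite psumr_eq0 => [/allP xv0|i _]; last exact: sqr_ge0.
suff v0 : v = 0.
  by move/sphereP: v1; rewrite v0 /dot mul0mx mxE => /eqP; rewrite eq_sym oner_eq0.
move/spansP: spI; apply => i iI.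
by have := xv0 i; rewrite mem_index_enum iI sqrf_eq0 => /(_ isT)/eqP.
Qed.

Lemma HessE th v : dot (v *m Hess y x th) v =
  \sum_(i < n) psi (y i * dot (x i) th) * dot (x i) v ^+ 2.
Proof. exact: dot_gram. Qed.

Lemma Hess_sym th : (Hess y x th)^T = Hess y x th.
Proof. exact: gram_sym. Qed.

Lemma Hess_ge0 th v : 0 <= dot (v *m Hess y x th) v.
Proof. by rewrite HessE sumr_ge0// => i _; rewrite mulr_ge0 ?psi_ge0 ?sqr_ge0. Qed.

Lemma Hess_le th v : sphere v ->
  dot (v *m Hess y x th) v <= lambda_max (\sum_(i < n) (x i)^T *m x i).
Proof.
move=> /sphereP v1; rewrite gram1E.
have [_ /(_ v)] := lambda_maxP (gram_sym (fun=> 1)); rewrite v1 mulr1.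
apply: le_trans; rewrite HessE dot_gram ler_sum// => i _.
by rewrite ler_wpM2r ?sqr_ge0 ?psi_le1.
Qed.

Lemma Hess_ge th : exists2 u, sphere u &
  forall v, 2 / pi * \sum_(i in Iu y x u) dot (x i) v ^+ 2 <= dot (v *m Hess y x th) v.
Proof.
suff [u u1 uth] : exists2 u, sphere u &
    forall i, i \in Iu y x u -> y i * dot (x i) th <= 0.
  exists u => // v; rewrite HessE mulr_sumr big_mkcond ler_sum// => i _.
  case: ifPn => [/uth ?|_]; last by rewrite mulr_ge0 ?psi_ge0 ?sqr_ge0.
  by rewrite ler_wpM2r ?sqr_ge0 ?psi_ge_2pi.
(* At [th = 0] every argument of [psi] is 0, so any unit [u] will do. *)
have [->|th0] := eqVneq th 0.
  have [u u1] := exists_sphere R d; exists u => // i _.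
  by rewrite dotC /dot mul0mx mxE mulr0.
exists ((Num.sqrt (dot th th))^-1 *: th); first exact: normalize.
move=> i; rewrite inE dotZr mulrCA pmulr_rle0// invr_gt0 sqrtr_gt0.
by rewrite dot_gt0.
Qed.

(** * Bounds on [minf], [Lsup] and the condition number *)

Lemma minf_ge (c : R) :
  (forall th v, sphere v -> c <= dot (v *m Hess y x th) v) -> (c%:E <= minf y x)%E.
Proof.
move=> h; apply: le_ereal_inf_tmp => _ [th _ <-]; rewrite lee_fin.
have [/eigenvalue_sphere[v v1 <-] _] := lambda_minP (Hess_sym th).
exact: h.
Qed.

Lemma minf_le th v : sphere v -> (minf y x <= (dot (v *m Hess y x th) v)%:E)%E.
Proof.
move=> /sphereP v1; apply: (@le_trans _ _ (lambda_min (Hess y x th))%:E).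
  by apply: ereal_inf_lbound; exists th.
by have [_ /(_ v)] := lambda_minP (Hess_sym th); rewrite v1 mulr1 lee_fin.
Qed.

Lemma Lsup_ge th v : sphere v -> ((dot (v *m Hess y x th) v)%:E <= Lsup y x)%E.
Proof.
move=> /sphereP v1; apply: (@le_trans _ _ (lambda_max (Hess y x th))%:E); last first.
  by apply: ereal_sup_ubound; exists th.
by have [_ /(_ v)] := lambda_maxP (Hess_sym th); rewrite v1 mulr1 lee_fin.
Qed.

Lemma Lsup_le : (Lsup y x <= (lambda_max (\sum_(i < n) (x i)^T *m x i))%:E)%E.
Proof.
apply: ge_ereal_sup => _ [th _ <-]; rewrite lee_fin.
have [/eigenvalue_sphere[v v1 <-] _] := lambda_maxP (Hess_sym th).
exact: Hess_le.
Qed.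

Lemma condnum_le (c : R) : 0 < c ->
  (forall th v, sphere v -> c <= dot (v *m Hess y x th) v) ->
  (condnum y x <= (lambda_max (\sum_(i < n) (x i)^T *m x i) / c)%:E)%E.
Proof.
move=> c0 /minf_ge cm; have [u u1] := exists_sphere R d.
have := Lsup_ge 0 u1; have := minf_le 0 u1; have := Lsup_le.
have := Hess_ge0 0 u; move: (lambda_max _) (dot _ _) => C q q0.
(* The four bounds rule out infinite values, leaving a quotient of reals. *)
rewrite /condnum; move: (minf y x) (Lsup y x) cm => [m||] [l||] //=.
rewrite !lee_fin => cm lC mq ql.
have m0 : 0 < m := lt_le_trans c0 cm.
rewrite /ediv eqe gt_eqF// inver gt_eqF//= lee_fin.
by rewrite ler_pM ?invr_ge0 ?(ltW m0) ?(le_trans q0)// lef_pV2.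
Qed.

Lemma condnum_fin : (forall u, sphere u -> spans x (Iu y x u)) ->
  (condnum y x < +oo)%E.
Proof.
move=> sp.
(* There are finitely many index sets, hence one constant for all [Iu y x u]. *)
have [c c0 cP] : exists2 c, 0 < c & forall I : {set 'I_n}, spans x I ->
    forall v, sphere v -> c <= \sum_(i in I) dot (x i) v ^+ 2.
  have /choice[f fP] : forall I : {set 'I_n}, exists c, spans x I ->
      0 < c /\ forall v, sphere v -> c <= \sum_(i in I) dot (x i) v ^+ 2.
    move=> I; have [/spans_bound[c c0 cI]|_] := boolP (spans x I).
      by exists c.
    by exists 0.
  have [c c0 cf] := @exists_lower_bound R _ f (spans x) (fun I sI => (fP I sI).1).
  exists c => // I sI v v1; exact: le_trans (cf _ sI) ((fP I sI).2 _ v1).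
have := @condnum_le (2 / pi * c); rewrite mulr_gt0 ?divr_gt0 ?pi_gt0//.
move=> /(_ isT) h; apply: le_lt_trans (h _) (ltry _) => th v v1.
have [u u1 /(_ v)] := Hess_ge th; apply: le_trans.
by rewrite ler_pM2l ?divr_gt0 ?pi_gt0// cP// sp.
Qed.

Lemma condnum_infty u : sphere u -> ~~ spans x (Iu y x u) -> condnum y x = +oo%E.
Proof.
move=> u1 nsp; suff m0 : minf y x = 0%E by rewrite /condnum /ediv m0 eqxx.
have [v v1 xv0] : exists2 v, sphere v & forall i, i \in Iu y x u -> dot (x i) v = 0.
  apply: contrapT => h; move/negP: nsp; apply; apply/spansP => v xv0.
  apply/eqP; apply: contrapT => /negP v0; apply: h.
  exists ((Num.sqrt (dot v v))^-1 *: v); first exact: normalize.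
  by move=> i /xv0; rewrite dotZr => ->; rewrite mulr0.
apply/eqP; rewrite eq_le minf_ge ?andbT => [|th w _]; last exact: Hess_ge0.
apply/lee_addgt0Pr => e e0; rewrite add0e.
(* [T] is large enough for [psi_le_inv] to apply and for [8 / T * S <= e]. *)
pose S := \sum_i dot (x i) v ^+ 2; pose T := 2 + 8 * S / e.
have S0 : 0 <= S by rewrite sumr_ge0// => i _; exact: sqr_ge0.
have T2 : 2 <= T by rewrite lerDl !mulr_ge0// invr_ge0 ltW.
have T0 : 0 < T by rewrite (lt_le_trans _ T2).
pose del i := y i * dot (x i) u.
have del0 i : i \notin Iu y x u -> 0 < del i by rewrite inE -ltNge.
(* A sum standing in for a maximum: each term is at most [t], so [t * del i >= T] for every [i]
   outside [Iu y x u]. *)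
pose t := \sum_(i | i \notin Iu y x u) T / del i.
have tT i : i \notin Iu y x u -> T <= t * del i.
  move=> iI; rewrite -ler_pdivrMr ?del0// /t (bigD1 i)//= lerDl sumr_ge0//.
  by move=> j /andP[jI _]; rewrite divr_ge0 ?ltW ?del0.
apply: le_trans (minf_le (t *: u) v1) _; rewrite lee_fin HessE.
apply: (@le_trans _ _ (8 / T * S)).
  rewrite mulr_sumr ler_sum// => i _.
  have [/xv0 ->|iI] := boolP (i \in Iu y x u); first by rewrite expr0n !mulr0.
  rewrite ler_wpM2r ?sqr_ge0// dotZr mulrCA -/(del i).
  apply: le_trans (psi_le_inv _) _; first exact: le_trans (tT _ iI).
  rewrite ler_pM2l// lef_pV2 ?posrE ?tT//.
  exact: lt_le_trans (tT _ iI).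
rewrite mulrAC ler_pdivrMr// /T mulrDr mulrC.
rewrite [e * (_ / e)]mulrC divfK ?gt_eqF// mulrC lerDr.
by rewrite mulr_ge0// ltW.
Qed.

Lemma condnum_fin_iff :
  (condnum y x < +oo)%E <-> (forall u, sphere u -> spans x (Iu y x u)).
Proof.
split=> [fin u u1|]; last exact: condnum_fin.
by apply: contraLR fin => /(condnum_infty u1) ->.
Qed.

(** Cardinalities are natural numbers, so a least one exists and the real infimum is a minimum. *)
Lemma sstar_attained : exists2 u, sphere u & sstar y x = #|Iu y x u|%:R /\
  forall v, sphere v -> (#|Iu y x u| <= #|Iu y x v|)%N.
Proof.
pose P m := `[< exists2 u, sphere u & #|Iu y x u| = m >].
have exP : exists m, P m.
  by have [u u1] := exists_sphere R d; exists #|Iu y x u|; apply/asboolP; exists u.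
case: (ex_minnP exP) => m /asboolP[u u1 um] mmin.
have umin v : sphere v -> (#|Iu y x u| <= #|Iu y x v|)%N.
  by move=> v1; rewrite um mmin//; apply/asboolP; exists v.
exists u => //; split => //; apply/eqP; rewrite eq_le; apply/andP; split.
  apply: ge_inf; last by exists u.
  by exists 0 => _ [v _ <-].
apply: lb_le_inf; first by exists #|Iu y x u|%:R, u.
by move=> _ [v v1 <-]; rewrite ler_nat umin.
Qed.

Lemma condnum_le_Pmin : (condnum y x <=
  ediv ((pi / 2 * lambda_max (\sum_(i < n) (x i)^T *m x i))%:E)
       (Pmin x (sstar y x))%:E)%E.
Proof.
have [u0 u01 [-> umin]] := sstar_attained.
set s := #|Iu y x u0| in umin *; rewrite /ediv eqe.
case: eqVneq => [_|P0]; first exact: leey.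
have Plb : lbound [set r | exists v, exists I : {set 'I_n},
    sphere v /\ (#|I|)%:R = s%:R :> R /\ r = \sum_(i in I) `|dot (x i) v| ^+ 2] 0.
  by move=> _ [v [I [_ [_ ->]]]]; rewrite sumr_ge0// => i _; rewrite sqr_ge0.
have Pgt0 : 0 < Pmin x s%:R.
  (* The infimum is over a nonempty set because [Iu y x u0] has exactly [s] elements. *)
  rewrite lt_def P0 /=; apply: lb_le_inf => //.
  by eexists; exists u0, (Iu y x u0); split; [|split].
have := @condnum_le (2 / pi * Pmin x s%:R).
rewrite mulr_gt0 ?divr_gt0 ?pi_gt0// => /(_ isT) h.
rewrite inver (negbTE P0) -EFinM.
apply: le_trans (h _) _; last first.
  rewrite lee_fin le_eqVlt; apply/orP; left; apply/eqP.
  have := pi_gt0 R; move: (pi : R) => p p0; field.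
  by rewrite P0 gt_eqF.
move=> th v v1; have [u u1 /(_ v)] := Hess_ge th; apply: le_trans.
rewrite ler_pM2l ?divr_gt0 ?pi_gt0//.
(* By minimality of [s], [Iu y x u] contains a subset of size exactly [s]; passing to it only drops
   nonnegative terms. *)
have [I IsubI Is] := exists_subset_card (umin _ u1).
apply: (@le_trans _ _ (\sum_(i in I) dot (x i) v ^+ 2)).
  apply: ge_inf; first by exists 0.
  exists v, I; split => //; split; first by rewrite Is.
  by apply: eq_bigr => i _; rewrite real_normK ?num_real.
rewrite [leLHS]big_mkcond [leRHS]big_mkcond ler_sum// => i _.
case: ifPn => [/(fintype.subsetP IsubI) ->//|_].
by case: ifP => // _; rewrite sqr_ge0.
Qed.

End Probit.

Theorem theorem2p1 (R : realType) (n d : nat) (hn : (0 < n)%N) (hd : (0 < d)%N)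
  (y : 'I_n -> R) (x : 'I_n -> 'rV[R]_(d.+1))
  (hy : forall i, y i = 1 \/ y i = -1) :
  (* (i) *)
  ((condnum y x < +oo)%E <->
     (forall u, sphere u -> spans x (Iu y x u)))
  /\
  (* (ii) *)
  ((forall I : {set 'I_n}, (d < #|I|)%N -> spans x I) ->
     ((condnum y x < +oo)%E <-> d%:R < sstar y x))
  /\
  (* (iii) *)
  (condnum y x <=
     ediv ((pi / 2 * lambda_max (\sum_(i < n) (x i)^T *m x i))%:E)
          (Pmin x (sstar y x))%:E)%E.
Proof.
split; first exact: condnum_fin_iff.
split; last exact: condnum_le_Pmin.
move=> sp; rewrite condnum_fin_iff.
have [u0 u01 [-> umin]] := sstar_attained y x; rewrite ltr_nat.
(* Spanning needs more than [d] vectors, applied at the minimizer [u0]; conversely every [Iu y x u]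
   is at least as large as [Iu y x u0]. *)
split=> [/(_ _ u01)/spans_card //|du u u1].
by apply: sp; exact: leq_trans (umin _ u1).
Qed.
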